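(* For complete information games and the fragment $ATL_0^*$, the satisfaction relations satisfy $$\models^{ATL_0^*}_{Ir}\ \subsetneq\ \models^{ATL_0^*}_{IF_2}\ \subsetneq\ \models^{ATL_0^*}_{IF_3}\ \subsetneq\ \cdots\ \subsetneq\ \models^{ATL_0^*}_{IF}\ =\ \models^{ATL_0^*}_{IR}.$$ That is: $\models^{ATL_0^*}_{Ir}\subsetneq\models^{ATL_0^*}_{IF_2}$; for every $k\ge 2$, $\models^{ATL_0^*}_{IF_k}\subsetneq\models^{ATL_0^*}_{IF_{k+1}}$ and $\models^{ATL_0^*}_{IF_k}\subsetneq\models^{ATL_0^*}_{IF}$; and $\models^{ATL_0^*}_{IF}=\models^{ATL_0^*}_{IR}$.
   Context: A concurrent game structure (CGS) with $n$ players is $\mathcal G=(\mathrm{States},\mathrm{Agt},\mathrm{Act},\mathrm{Mov},\mathrm{Tab})$ with $\mathrm{States}$ a finite non-empty set, $\mathrm{Agt}=\{1,\dots,n\}$ non-empty, $\mathrm{Act}$ a finite non-empty set, $\mathrm{Mov}:\mathrm{States}\times\mathrm{Agt}\to 2^{\mathrm{Act}}\setminus\{\emptyset\}$ the legal actions, and $\mathrm{Tab}(s,(a_1,\dots,a_n))\in\mathrm{States}$ defined for every state $s$ and all $(a_1,\dots,a_n)$ with $a_j\in\mathrm{Mov}(s,j)$ (such tuples are called moves). A concurrent game model (CGM) is $\mathcal M=(\mathcal G,\pi)$ with $\pi:\mathrm{States}\to 2^{\mathrm{Prop}}$, where $\mathrm{Prop}$ is a finite set of propositions. An outcome is an infinite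 sequence of states in which each consecutive pair is connected by some move; a history is a non-empty finite prefix of an outcome. A perfect recall strategy ($Y=R$) for player $j$ maps each history $h$ to an action in $\mathrm{Mov}(\mathrm{last}(h),j)$, where $\mathrm{last}(h)$ is the last state of $h$. It is memoryless ($Y=r$) if it depends only on the last state. It is a $k$-memory strategy ($Y=F_k$, $k\ge1$) if there is a deterministic finite-state transducer with a set $M$ of $k$ memory states, initial state $m_0\in M$, transition function $T:M\times\mathrm{States}\to M$ and output function $G:M\times\mathrm{States}\to\mathrm{Act}$ such that on each history $h_0\cdots h_l$ the strategy plays $G(m_l,h_l)$, where $m_{i+1}=T(m_i,h_i)$. It is a finite-memory strategy ($Y=F$) if it is $k$-memory for some $k\ge1$. $\mathrm{Strat}^Y_j$ denotes the set of strategies of type $Y$ for player $j$; memoryless strategies are the same as 1-memory strategies. $\mathrm{Out}_{\mathcal G}(s,\sigma_A)$ is the set of outcomes from $s$ that are possible when each $a\in A$ follows $\sigma_a$ (the remaining players choosing arbitrary legal actions). $ATL_0^*$ consists of the formulas $\langle\!\langle A\rangle\!\rangle\varphi$ with $A\subseteq\mathrm{Agt}$ and $\varphi$ an LTL formula over $\mathrm{Prop}$ (built from propositions, $\neg,\vee,\mathbf X,\mathbf U$, evaluated on infinite paths as usual). $\mathcal M,s\models_{IY}\langle\!\langle A\rangle\!\rangle\varphi$ holds iff there are strategies $(\sigma_a)_{a\in A}\in\prod_{a\in A}\mathrm{Strat}^Y_a$ such that every $\rho\in\mathrm{Out}_{\mathcal G}(s,\sigma_A)$ satisfies $\varphi$.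 $\models^{ATL_0^*}_{IY}$ is regarded as the set of triples $(\mathcal M,s,\psi)$ with $\mathcal M$ a CGM (over any finite $\mathrm{Agt}$ and $\mathrm{Prop}$), $s$ a state, $\psi$ an $ATL_0^*$ formula and $\mathcal M,s\models_{IY}\psi$; inclusion and equality refer to these sets. *)

(* Defs.v *)
From HB Require Import structures.
From mathcomp Require Import all_boot.

Set Implicit Arguments.
Unset Strict Implicit.
Unset Printing Implicit Defensive.

(* The agents are 'I_n, numbered from 0. [Tab] is defined on moves only, i.e. on
   action profiles that are legal for every agent. *)
Record cgs (n : nat) : Type := CGS {
  State : finType;
  Act : finType;
  Mov : State -> 'I_n -> {set Act};
  Tab : forall s : State,
    {m : {ffun 'I_n -> Act} | [forall j, m j \in Mov s j]} -> State;
  agents_gt0 : 0 < n;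
  State_gt0 : 0 < #|State|;
  Act_gt0 : 0 < #|Act|;
  Mov_neq0 : forall s j, Mov s j != set0
}.

Record cgm (n : nat) (AP : finType) : Type := CGM {
  structure :> cgs n;
  label : State structure -> {set AP}
}.

Section Strategies.
Variables (n : nat) (G : cgs n).

Definition move (s : State G) : Type :=
  {m : {ffun 'I_n -> Act G} | [forall j, m j \in Mov s j]}.

Definition outcome (rho : nat -> State G) : Prop :=
  forall i, exists m : move (rho i), Tab m = rho i.+1.

(* The history rho_0 ... rho_l, whose last state is rho_l. *)
Definition history (rho : nat -> State G) (l : nat) : seq (State G) :=
  mkseq rho l.+1.

(* Strategies are total functions on sequences, but every condition below
   concerns their values on histories (prefixes of outcomes) only. *)
Definition strategy : Type := seq (State G) -> Act G.

Definition perfect_recall (j : 'I_n) (sigma : strategy) : Prop :=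
  forall rho l, outcome rho -> sigma (history rho l) \in Mov (rho l) j.

Definition memoryless (sigma : strategy) : Prop :=
  exists f : State G -> Act G,
    forall rho l, outcome rho -> sigma (history rho l) = f (rho l).

Record transducer : Type := Transducer {
  memory : finType;
  mem_init : memory;
  mem_update : memory -> State G -> memory;
  mem_output : memory -> State G -> Act G
}.

(* The state m_l reached after reading rho_0 ... rho_(l-1); the last state
   rho_l of the history is read by the output function only. *)
Definition mem_at (D : transducer) (rho : nat -> State G) (l : nat) : memory D :=
  foldl (@mem_update D) (mem_init D) (mkseq rho l).

Definition k_memory (k : nat) (sigma : strategy) : Prop :=
  exists D : transducer, #|memory D| = k /\
    forall rho l, outcome rho ->
      sigma (history rho l) = mem_output (mem_at D rho l) (rho l).

End Strategies.

(* r, F_k, F and R *)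
Inductive strategy_type : Type :=
  | Memoryless
  | KMemory of nat
  | FiniteMemory
  | PerfectRecall.

Definition Strat (n : nat) (G : cgs n) (Y : strategy_type) (j : 'I_n)
    (sigma : strategy G) : Prop :=
  perfect_recall j sigma /\
  match Y with
  | Memoryless => memoryless sigma
  | KMemory k => k_memory k sigma
  | FiniteMemory => exists2 k, 1 <= k & k_memory k sigma
  | PerfectRecall => True
  end.

(* The components of [sigma] outside the coalition [A] are irrelevant. *)
Definition Out (n : nat) (G : cgs n) (s : State G) (A : {set 'I_n})
    (sigma : 'I_n -> strategy G) (rho : nat -> State G) : Prop :=
  rho 0 = s /\
  forall i, exists m : move (rho i),
    (forall a, a \in A -> val m a = sigma a (history rho i)) /\
    Tab m = rho i.+1.

Inductive ltl (AP : Type) : Type :=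
  | LProp of AP
  | LNot of ltl AP
  | LOr of ltl AP & ltl AP
  | LNext of ltl AP
  | LUntil of ltl AP & ltl AP.

Fixpoint ltl_sat (AP : finType) (w : nat -> {set AP}) (i : nat) (phi : ltl AP)
    : Prop :=
  match phi with
  | LProp p => p \in w i
  | LNot phi1 => ~ ltl_sat w i phi1
  | LOr phi1 phi2 => ltl_sat w i phi1 \/ ltl_sat w i phi2
  | LNext phi1 => ltl_sat w i.+1 phi1
  | LUntil phi1 phi2 => exists j, [/\ i <= j, ltl_sat w j phi2 &
      forall k, i <= k < j -> ltl_sat w k phi1]
  end.

(* <<coalition>> goal *)
Record atl0 (n : nat) (AP : finType) : Type := ATL0 {
  coalition : {set 'I_n};
  goal : ltl AP
}.

Definition atl0_sat (Y : strategy_type) (n : nat) (AP : finType) (M : cgm n AP)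
    (s : State M) (psi : atl0 n AP) : Prop :=
  exists sigma : 'I_n -> strategy M,
    (forall a, a \in coalition psi -> Strat Y a (sigma a)) /\
    forall rho, Out s (coalition psi) sigma rho ->
      ltl_sat (fun i => label (rho i)) 0 (goal psi).

Record triple : Type := Triple {
  nb_agents : nat;
  props : finType;
  model : cgm nb_agents props;
  init : State model;
  formula : atl0 nb_agents props
}.

Definition models (Y : strategy_type) (t : triple) : Prop :=
  atl0_sat Y (init t) (formula t).

Definition strictly_included (T : Type) (P Q : T -> Prop) : Prop :=
  (forall t, P t -> Q t) /\ exists t, Q t /\ ~ P t.

Definition same_set (T : Type) (P Q : T -> Prop) : Prop :=
  forall t, P t <-> Q t.

(* Main.v *)
Require Import Defs.
From HB Require Import structures.
From mathcomp Require Import all_boot.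
From Stdlib Require Import Classical ClassicalEpsilon.

Set Implicit Arguments.
Unset Strict Implicit.
Unset Printing Implicit Defensive.

(** LTL truth values are computed backwards along a word, so every finite block
    of letters acts on them as an element of a finite monoid. Starting a new
    block whenever two running blocks have acted alike turns satisfaction of a
    formula into a Rabin condition on a finite deterministic tracker. In the
    product of the game structure with this tracker the protagonist either wins
    positionally, that is, with finite memory, or the opponent wins: split the
    choices available at one vertex and shuffle the two opponent strategies,
    since Streett conditions are closed under shuffles. The inclusions are strict
    because staying exactly [k.+1] steps in one state requires [k.+1] memory
    states. *)

(** * Properties that hold infinitely often *)

Definition io (P : nat -> Prop) : Prop := forall n, exists2 t, n <= t & P t.

Lemma io_mono (P Q : nat -> Prop) : (forall t, P t -> Q t) -> io P -> io Q.
Proof. by move=> PQ ioP n; have [t le_nt /PQ] := ioP n; exists t. Qed.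

Lemma not_ioP (P : nat -> Prop) :
  ~ io P <-> exists n, forall t, n <= t -> ~ P t.
Proof.
split=> [nio | [n nP] /(_ n) [t le_nt Pt]]; last exact: nP Pt.
have [n nH] := not_all_ex_not _ _ nio.
by exists n => t le_nt Pt; apply: nH; exists t.
Qed.

Lemma io_or (P Q : nat -> Prop) :
  io (fun t => P t \/ Q t) -> io P \/ io Q.
Proof.
move=> ioPQ; case: (classic (io P)) => [|/not_ioP [n nP]]; [by left | right].
move=> m; have [t] := ioPQ (maxn n m).
rewrite geq_max => /andP [le_nt le_mt] [/(nP t le_nt) // | Qt].
by exists t.
Qed.

(** Infinite pigeonhole: [io_or] splits off one index at a time. *)
Lemma io_exists (I : finType) (P : I -> nat -> Prop) :
  io (fun t => exists i, P i t) -> exists i, io (P i).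
Proof.
move=> ioP; suff [i _ ioPi]: exists2 i, i \in enum I & io (P i) by exists i.
have: io (fun t => exists2 i, i \in enum I & P i t).
  by apply: io_mono ioP => t [i Pit]; exists i; rewrite ?mem_enum.
elim: (enum I) => [|i s IHs ios]; first by move=> /(_ 0) [t _ []].
have: io (fun t => P i t \/ exists2 j, j \in s & P j t).
  apply: io_mono ios => t [j]; rewrite inE => /orP [/eqP -> | js] Pj.
    by left.
  by right; exists j.
case/io_or => [ioPi | /IHs [j js ioPj]].
  by exists i; rewrite ?mem_head.
by exists j; rewrite // inE js orbT.
Qed.

Lemma ord_min_ex n (P : 'I_n -> Prop) :
  (exists p, P p) -> exists p, P p /\ forall p' : 'I_n, p' < p -> ~ P p'.
Proof.
move=> [p Pp]; have [m le_pm] := ubnP (val p).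
elim: m p le_pm Pp => // m IHm p le_pm Pp.
case: (classic (exists2 p' : 'I_n, p' < p & P p')) => [[p' lt_p'p]|min_p].
  by apply: IHm; apply: leq_trans lt_p'p _.
by exists p; split=> // p' lt_p'p Pp'; apply: min_p; exists p'.
Qed.

(** * Games with a Rabin objective *)

Section Game.
Variables (V C : finType) (D : Type) (sc : V -> C -> D -> V).
Variables (I : finType) (good bad : I -> V -> bool).

Definition rabin (rho : nat -> V) : Prop :=
  exists i, io (fun t => good i (rho t)) /\ ~ io (fun t => bad i (rho t)).

Definition streett (rho : nat -> V) : Prop :=
  forall i, io (fun t => good i (rho t)) -> io (fun t => bad i (rho t)).

Lemma not_rabin rho : ~ rabin rho -> streett rho.
Proof.
move=> nR i gi; apply: NNPP => nb; apply: nR.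
by exists i.
Qed.

Lemma streett_not_rabin rho : streett rho -> ~ rabin rho.
Proof. by move=> st [i [/st]]. Qed.

Lemma rabin_unshift rho T : rabin (fun t => rho (T + t)) -> rabin rho.
Proof.
move=> [i [gi /not_ioP [n nb]]]; exists i; split.
  move=> m; have [t le_t gt] := gi m.
  by exists (T + t) => //; apply: leq_trans le_t (leq_addl _ _).
apply/not_ioP; exists (T + n) => t le_t.
have le_Tt: T <= t by apply: leq_trans le_t; rewrite leq_addr.
by rewrite -(subnKC le_Tt); apply: nb; rewrite leq_subRL.
Qed.

Definition positional_win (av : V -> {set C}) (v : V) (f : V -> C) : Prop :=
  (forall u, f u \in av u) /\
  forall rho ds, rho 0 = v ->
    (forall t, rho t.+1 = sc (rho t) (f (rho t)) (ds t)) -> rabin rho.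

(* A strategy of the opponent is a possibly infinite machine that sees the
   choice of the protagonist before it answers. *)
Record machine : Type := Machine {
  mstate : Type;
  minit : mstate;
  manswer : mstate -> V -> C -> D;
  mnext : mstate -> V -> C -> mstate
}.

Definition machine_win (av : V -> {set C}) (v : V) (Z : machine) : Prop :=
  forall (rho : nat -> V) (zs : nat -> mstate Z) (cs : nat -> C),
    rho 0 = v -> zs 0 = minit Z ->
    (forall t, cs t \in av (rho t)) ->
    (forall t, rho t.+1 = sc (rho t) (cs t) (manswer (zs t) (rho t) (cs t))) ->
    (forall t, zs t.+1 = mnext (zs t) (rho t) (cs t)) ->
    streett rho.

(** The steps with [adv] form a play against [Z], since position and machine wait in between.
    Recurrence of [good i] at such steps makes them infinitely many. *)
Lemma machine_win_stutter av v Z (adv : nat -> bool) (u : nat -> V)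
    (zs : nat -> mstate Z) (cs : nat -> C) :
  machine_win av v Z -> u 0 = v -> zs 0 = minit Z ->
  (forall t, adv t -> [/\ cs t \in av (u t),
     u t.+1 = sc (u t) (cs t) (manswer (zs t) (u t) (cs t)) &
     zs t.+1 = mnext (zs t) (u t) (cs t)]) ->
  (forall t, ~~ adv t -> u t.+1 = u t /\ zs t.+1 = zs t) ->
  forall i, io (fun t => adv t && good i (u t)) ->
    io (fun t => adv t && bad i (u t)).
Proof.
move=> Zwin u0 z0 go stay i gi.
have ioadv n : exists t, (n <= t) && adv t.
  by have [t le_nt /andP [at_ _]] := gi n; exists t; rewrite le_nt.
pose nx n := ex_minn (ioadv n).
have nxP n : [/\ n <= nx n, adv (nx n) &
    forall t, n <= t -> adv t -> nx n <= t].
  rewrite /nx; case: ex_minnP => m /andP [le_nm am] min_m; split=> // t lt at_.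
  by apply: min_m; rewrite lt.
have frozen n t : n <= t -> t <= nx n -> u t = u n /\ zs t = zs n.
  elim: t => [|t IHt]; first by rewrite leqn0 => /eqP ->.
  rewrite leq_eqVlt => /orP [/eqP -> // | le_nt lt_t].
  have [_ _ min_n] := nxP n.
  have nat_ : ~~ adv t.
    by apply/negP => /(min_n t le_nt) le; move: (leq_trans lt_t le); rewrite ltnn.
  have [eu ez] := stay t nat_; rewrite eu ez; exact: IHt le_nt (ltnW lt_t).
(* [tm] enumerates the times with [adv] in increasing order. *)
pose tm := fix tm n := if n is m.+1 then nx (tm m).+1 else nx 0.
have adv_tm n : adv (tm n) by case: n => [|n] /=; [case: (nxP 0) | case: (nxP (tm n).+1)].
have tm_lt n : tm n < tm n.+1 by case: (nxP (tm n).+1).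
have tm_ge n : n <= tm n.
  by elim: n => // n IHn; apply: leq_ltn_trans IHn (tm_lt n).
have tm_onto T N : adv T -> tm N <= T -> exists2 n, N <= n & tm n = T.
  move=> aT; have [m] := ubnP (T - tm N).
  elim: m N => // m IHm N lt_m; rewrite leq_eqVlt => /orP [/eqP <- |lt_NT].
    by exists N.
  have [_ _ /(_ T lt_NT aT) le_T] := nxP (tm N).+1.
  have [||n lt_Nn eq_T] := IHm N.+1 => //; last first.
    by exists n => //; apply: ltnW.
  have lt1: T - tm N.+1 < T - tm N by apply: ltn_sub2l (tm_lt N).
  by apply: leq_trans lt1 _.
have st := Zwin (u \o tm) (zs \o tm) (cs \o tm).
have {st}: streett (u \o tm).
  apply: st => /=.
  - by have [||-> _] := frozen 0 (nx 0).
  - by have [||_ ->] := frozen 0 (nx 0).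
  - by move=> t; case: (go _ (adv_tm t)).
  - move=> t; have [_ <- _] := go _ (adv_tm t).
    by have [||-> _] := frozen (tm t).+1 (nx (tm t).+1) => //; case: (nxP (tm t).+1).
  - move=> t; have [_ _ <-] := go _ (adv_tm t).
    by have [||_ ->] := frozen (tm t).+1 (nx (tm t).+1) => //; case: (nxP (tm t).+1).
move=> /(_ i) st n.
have /st /(_ n) [t le_nt bt] : io (fun t => good i ((u \o tm) t)).
  move=> m; have [T le_T /andP [aT gT]] := gi (tm m).
  by have [k le_mk eT] := tm_onto T m aT le_T; exists k; rewrite //= eT.
by exists (tm t); rewrite ?adv_tm //; apply: leq_trans le_nt (tm_ge t).
Qed.

Section Split.
Variables (av : V -> {set C}) (v0 : V) (c0 : C).

Definition av1 (v : V) : {set C} := if v == v0 then [set c0] else av v.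
Definition av2 (v : V) : {set C} := if v == v0 then av v :\ c0 else av v.

(* Two plays are interleaved: the flag tells which one is running, and the
   other one waits at [v0]. *)
Definition shuffle (Z1 Z2 : machine) : machine :=
  let turn b v c := if v == v0 then c == c0 else b in
  @Machine (mstate Z1 * mstate Z2 * bool)
    (minit Z1, minit Z2, true)
    (fun z v c => if turn z.2 v c then manswer z.1.1 v c
                  else manswer z.1.2 v c)
    (fun z v c => if turn z.2 v c then (mnext z.1.1 v c, z.1.2, true)
                  else (z.1.1, mnext z.1.2 v c, false)).

(** A recurring [good i] recurs within one of the two interleaved plays, whose Streett condition
    makes [bad i] recur as well. *)
Lemma shuffle_win v Z1 Z2 :
  machine_win av1 v Z1 -> machine_win av2 v0 Z2 ->
  machine_win av v (shuffle Z1 Z2).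
Proof.
move=> win1 win2 rho zs cs rho0 zs0 legal step zstep i gi.
pose b t := (zs t).2.
have bS t : b t.+1 = if rho t == v0 then cs t == c0 else b t.
  by rewrite /b zstep /=; case: ifP.
(* Positions of the two plays; [b t.+1] tells which of them makes the move at time [t]. *)
pose u1 t := if b t then rho t else v0.
pose u2 t := if b t then v0 else rho t.
have S1 := @machine_win_stutter _ _ _ (fun t => b t.+1) u1
             (fun t => (zs t).1.1) cs win1.
have S2 := @machine_win_stutter _ _ _ (fun t => ~~ b t.+1) u2
             (fun t => (zs t).1.2) cs win2.
(* The flag changes only at [v0], where the other play waits, so the play that moves is always at
   [rho t]. *)
have eq1 t : b t.+1 -> u1 t = rho t.
  by rewrite bS /u1; case: eqP => [->|_ ->] //; case: ifP.
have eq2 t : ~~ b t.+1 -> u2 t = rho t.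
  by rewrite bS /u2; case: eqP => [->|_ /negbTE ->] //; case: ifP.
have {}S1 : io (fun t => b t.+1 && good i (rho t)) ->
            io (fun t => bad i (rho t)).
  move=> g1; apply: (io_mono _ (S1 _ _ _ _ i _)).
  - by move=> t /andP [/eq1 ->].
  - by rewrite /u1 /b zs0.
  - by rewrite zs0.
  - move=> t bt; rewrite eq1 // /u1 bt step zstep /=.
    have := bt; rewrite bS -/(b t) => ->; split=> //.
    by have := bt; rewrite bS /av1; case: eqP => // _ /eqP ->; rewrite inE.
  - move=> t nbt; rewrite /u1 (negbTE nbt) zstep /=.
    move: (nbt); rewrite bS -/(b t) => /negbTE H; rewrite H; split=> //.
    by move: H; case: eqP => [->|_ ->] //; case: ifP.
  - by apply: io_mono g1 => t /andP [bt gt]; rewrite bt eq1.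
have {}S2 : io (fun t => ~~ b t.+1 && good i (rho t)) ->
            io (fun t => bad i (rho t)).
  move=> g1; apply: (io_mono _ (S2 _ _ _ _ i _)).
  - by move=> t /andP [/eq2 ->].
  - by rewrite /u2 /b zs0.
  - by rewrite zs0.
  - move=> t nbt; rewrite eq2 // /u2 (negbTE nbt) step zstep /=.
    have := nbt; rewrite bS -/(b t) => /negbTE ->; split=> //.
    have := nbt; rewrite bS /av2; case: eqP => [_ nc|_ _] //.
    by rewrite in_setD1 nc legal.
  - move=> t; rewrite negbK => bt; rewrite /u2 bt zstep /=.
    move: (bt); rewrite bS -/(b t) => H; rewrite H; split=> //.
    by move: H; case: eqP => [->|_ ->] //; case: ifP.
  - by apply: io_mono g1 => t /andP [bt gt]; rewrite bt eq2.
have /io_or [/S1 //|/S2 //] : io (fun t => b t.+1 && good i (rho t) \/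
                             ~~ b t.+1 && good i (rho t)).
by apply: io_mono gi => t gt; case: (b t.+1); [left|right].
Qed.

(* A play reaching [v0] could be continued with the positional strategy that
   wins from there, so no play against [Z] reaches [v0]. *)
Lemma avoid_win v f Z :
  positional_win av2 v0 f -> machine_win av2 v Z -> machine_win av v Z.
Proof.
move=> [fav fwin] Zwin rho zs cs rho0 zs0 legal step zstep.
have [rv0|nv0] := classic (exists t, rho t == v0); last first.
  apply: (Zwin rho zs cs) => // t; have := legal t.
  rewrite /av2; case: eqP => // e.
  by case: nv0; exists t; apply/eqP.
have [T /eqP rT Tmin] := ex_minnP rv0.
pose nxt (x : V * mstate Z) :=
  (sc x.1 (f x.1) (manswer x.2 x.1 (f x.1)), mnext x.2 x.1 (f x.1)).
pose pl t := iter t nxt (rho T, zs T).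
(* Up to the first visit [T] to [v0] the given play is kept; from then on [f] plays against [Z],
   which continues from the state it has reached. *)
pose rho' t := if t < T then rho t else (pl (t - T)).1.
pose zs' t := if t < T then zs t else (pl (t - T)).2.
pose cs' t := if t < T then cs t else f (rho' t).
have shift t : T <= t -> t.+1 - T = (t - T).+1 by move=> ?; rewrite subSn.
have rhoT : rho' T = rho T by rewrite /rho' ltnn subnn.
have win : rabin (fun t => rho' (T + t)).
  apply: (fwin _ (fun t => manswer (zs' (T + t)) (rho' (T + t)) (f (rho' (T + t))))).
    by rewrite addn0 rhoT.
  move=> t; rewrite /rho' /zs' !ltnNge !leq_addr /=.
  by rewrite !addKn.
(* The glued play would be won by both sides: it is Rabin thanks to [f], and Streett because it
   respects [av2] throughout. *)
case: (streett_not_rabin _ (rabin_unshift win)).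
have next t : rho' t.+1 = sc (rho' t) (cs' t) (manswer (zs' t) (rho' t) (cs' t))
    /\ zs' t.+1 = mnext (zs' t) (rho' t) (cs' t).
  rewrite /cs' /rho' /zs'; have [lt_tT|le_Tt] := ltnP t T.
    move: lt_tT; rewrite leq_eqVlt => /orP [/eqP eT|->]; last by [].
    by rewrite eT ltnn subnn /= -eT step zstep.
  by rewrite ltnNge (leqW le_Tt) /= shift.
apply: (Zwin rho' zs' cs').
- by rewrite /rho'; case: (posnP T) => // T0; rewrite sub0n /= T0.
- by rewrite /zs'; case: (posnP T) => // T0; rewrite sub0n /= T0.
- move=> t; rewrite /cs'; case: ifP => lt_tT; last exact: fav.
  rewrite /rho' lt_tT /av2; case: eqP => [/eqP /Tmin|_]; last exact: legal.
  by rewrite leqNgt lt_tT.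
- by move=> t; case: (next t).
- by move=> t; case: (next t).
Qed.

Lemma positional_win_sub (av' : V -> {set C}) v f :
  (forall u, av' u \subset av u) -> positional_win av' v f ->
  positional_win av v f.
Proof.
by move=> sub [fav fwin]; split=> // u; apply: (subsetP (sub u)).
Qed.

End Split.

(** Induction on the total number of choices. If [v0] has two choices, either keep only [c0] there
    or drop [c0]. A protagonist winning one of these games from [v] wins the full game. Otherwise
    the opponent shuffles two machines if one wins from [v0] without [c0], and else relies on
    [avoid_win]. *)
Lemma rabin_determined (av : V -> {set C}) v :
  (forall u, av u != set0) ->
  (exists f, positional_win av v f) \/ (exists Z, machine_win av v Z).
Proof.
have [m] := ubnP (\sum_u #|av u|).
elim: m av v => // m IHm av v le_m av_n0.
have [[v0 card_v0]|small] := classic (exists v0, 1 < #|av v0|); last first.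
  have [f fav] : exists f : V -> C, forall u, f u \in av u.
    exists (fun u => sval (sigW (set0Pn _ (av_n0 u)))) => u.
    by case: (sigW _).
  have uniq_f u c : c \in av u -> c = f u.
    move=> cav; apply/eqP; apply: contraT => ne.
    case: small; exists u; apply/card_gt1P; exists c, (f u).
    by split.
  case: (classic (positional_win av v f)) => [|nf]; first by left; exists f.
  right; have [rho [ds [r0 [step nwin]]]] : exists rho ds, rho 0 = v /\
      (forall t, rho t.+1 = sc (rho t) (f (rho t)) (ds t)) /\ ~ rabin rho.
    apply: NNPP => H; apply: nf; split=> // rho ds r0 step.
    by apply: NNPP => nw; apply: H; exists rho, ds.
  (* All choices are forced, so reciting the answers of one play that [f] loses reproduces that
     play. *)
  exists (@Machine nat 0 (fun t _ _ => ds t) (fun t _ _ => t.+1)).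
  move=> rho' zs cs r'0 zs0 legal step' zstep.
  have zsE t : zs t = t by elim: t => // t IHt; rewrite zstep IHt.
  have rE t : rho' t = rho t.
    elim: t => [|t IHt]; first by rewrite r0.
    by rewrite step' step (uniq_f _ _ (legal t)) zsE IHt.
  move=> i gi; apply: io_mono (not_rabin nwin (i := i) _) => [t|].
    by rewrite rE.
  by apply: io_mono gi => t; rewrite rE.
have /set0Pn [c0 c0av] := av_n0 v0.
have sub1 u : av1 av v0 c0 u \subset av u.
  by rewrite /av1; case: eqP => // ->; rewrite sub1set.
have sub2 u : av2 av v0 c0 u \subset av u.
  by rewrite /av2; case: eqP => // ->; apply: subD1set.
have decr (av' : V -> {set C}) : (forall u, av' u \subset av u) ->
    #|av' v0| < #|av v0| -> \sum_u #|av' u| < m.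
  move=> sub lt0; apply: leq_trans (_ : \sum_u #|av u| <= m); last by [].
  rewrite (bigD1 v0) //= [X in _ < X](bigD1 v0) //= -addSn.
  by apply: leq_add lt0 _; apply: leq_sum => u _; apply: subset_leq_card.
have m1 : \sum_u #|av1 av v0 c0 u| < m.
  by apply: decr sub1 _; rewrite /av1 eqxx cards1.
have m2 : \sum_u #|av2 av v0 c0 u| < m.
  by apply: decr sub2 _; rewrite /av2 eqxx [X in _ < X](cardsD1 c0) c0av.
have n1 u : av1 av v0 c0 u != set0.
  by rewrite /av1; case: (u =P v0) => // _; apply/set0Pn; exists c0; rewrite inE.
have n2 u : av2 av v0 c0 u != set0.
  rewrite /av2; case: (u =P v0) => // ->; rewrite -card_gt0.
  by move: card_v0; rewrite (cardsD1 c0) c0av.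
have [[f fw]|[Z1 w1]] := IHm _ v m1 n1.
  by left; exists f; apply: positional_win_sub sub1 fw.
have [[f0 f0w]|[Z2 w2]] := IHm _ v0 m2 n2; last first.
  by right; exists (shuffle v0 c0 Z1 Z2); apply: shuffle_win.
have [[f fw]|[Z2 w2]] := IHm _ v m2 n2.
  by left; exists f; apply: positional_win_sub sub2 fw.
by right; exists Z2; apply: avoid_win f0w w2.
Qed.

End Game.

(** * A prophetic automaton for LTL *)

Section Prophecy.
Variables (L : Type) (X U : finType).
Variables (F : L -> X -> X) (seen : U -> X -> bool).

(** The state at [t] is computed from the state at [t.+1], so a run makes claims about the future;
    [fair] is to exclude the wrong ones. *)
Definition back_run (w : nat -> L) (x : nat -> X) : Prop :=
  forall t, x t = F (w t) (x t.+1).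

Definition fair (x : nat -> X) : Prop := forall u, io (fun t => seen u (x t)).

End Prophecy.

Lemma fair_sum (X1 X2 X U1 U2 : finType) (s1 : U1 -> X1 -> bool)
    (s2 : U2 -> X2 -> bool) (p1 : X -> X1) (p2 : X -> X2) (x : nat -> X) :
  fair (fun u y => match u with inl u1 => s1 u1 (p1 y) | inr u2 => s2 u2 (p2 y) end) x
  <-> fair s1 (p1 \o x) /\ fair s2 (p2 \o x).
Proof.
split=> [fx | [f1 f2] [u|u]]; [|exact: f1|exact: f2].
by split=> u; [exact: (fx (inl u))|exact: (fx (inr u))].
Qed.

Definition truth (P : Prop) : bool := excluded_middle_informative P.

Lemma truthP (P : Prop) : reflect P (truth P).
Proof. by rewrite /truth; case: excluded_middle_informative => ?; constructor. Qed.

Lemma ltl_until_step (AP : finType) (w : nat -> {set AP}) i f g :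
  ltl_sat w i (LUntil f g) <->
  ltl_sat w i g \/ ltl_sat w i f /\ ltl_sat w i.+1 (LUntil f g).
Proof.
split=> /= [[j [le_ij gj fk]]|[gi|[fi [j [lt_ij gj fk]]]]].
- move: le_ij; rewrite leq_eqVlt => /orP [/eqP ->|lt_ij]; [by left|right].
  split; first by apply: fk; rewrite leqnn.
  by exists j; split=> // k /andP [lt_ik lt_kj]; apply: fk; rewrite ltnW.
- by exists i; split=> // k /andP [le_ik lt_ki]; move: (leq_ltn_trans le_ik lt_ki); rewrite ltnn.
- exists j; split=> //; first exact: ltnW.
  move=> k /andP []; rewrite leq_eqVlt => /orP [/eqP <- //|lt_ik lt_kj].
  by apply: fk; rewrite lt_ik.
Qed.

(** The run that records the actual truth values is fair, and every fair run is right at its root.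
    Only [LUntil] adds a fairness index, which keeps a promise from being deferred forever. *)
Lemma ltl_prophecy (AP : finType) (phi : ltl AP) :
  exists (X U : finType) (F : {set AP} -> X -> X) (seen : U -> X -> bool)
         (root : X -> bool), forall w : nat -> {set AP},
    (exists x, back_run F w x /\ fair seen x) /\
    (forall x, back_run F w x -> fair seen x ->
       forall t, root (x t) <-> ltl_sat w t phi).
Proof.
elim: phi => [p|f|f IHf g IHg|f|f IHf g IHg].
- exists bool, void, (fun (a : {set AP}) _ => p \in a), (fun _ _ => true), id => w.
  split; first by exists (fun t => p \in w t); split=> [t|[]].
  by move=> x run _ t; rewrite run.
- move=> [X [U [F [seen [root H]]]]].
  exists X, U, F, seen, (fun x => ~~ root x) => w; have [ex sat] := H w.
  split=> // x run fx t; have [s1 s2] := sat x run fx t.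
  by split=> [/negP nr /s2 //|ns]; apply/negP => /s1.
- have [X1 [U1 [F1 [s1 [r1 H1]]]]] := IHf.
  have [X2 [U2 [F2 [s2 [r2 H2]]]]] := IHg.
  exists (X1 * X2)%type, (U1 + U2)%type, (fun a x => (F1 a x.1, F2 a x.2)),
    (fun u x => match u with inl u => s1 u x.1 | inr u => s2 u x.2 end),
    (fun x => r1 x.1 || r2 x.2) => w.
  have [[x1 [run1 fair1]] sat1] := H1 w; have [[x2 [run2 fair2]] sat2] := H2 w.
  split.
    exists (fun t => (x1 t, x2 t)); split; last exact/fair_sum.
    by move=> t /=; rewrite [in LHS]run1 [in LHS]run2.
  move=> x run /fair_sum [f1 f2] t /=.
  have {}sat1 := sat1 (fst \o x) (fun t => congr1 fst (run t)) f1 t.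
  have {}sat2 := sat2 (snd \o x) (fun t => congr1 snd (run t)) f2 t.
  split=> [/orP [/sat1|/sat2]|[/sat1 /= ->|/sat2 /= ->]] //; by [left|right|rewrite orbT].
- move=> [X [U [F [seen [root H]]]]].
  (* Here [x] is the state one position later, so its own [root] is the value that [LNext f]
     needs. *)
  exists (X * bool)%type, U, (fun a x => (F a x.1, root x.1)),
    (fun u x => seen u x.1), snd => w.
  have [[x [run fx]] sat] := H w; split.
    exists (fun t => (x t, root (x t.+1))); split=> // t /=.
    by rewrite [in LHS]run.
  move=> y yrun yfair t; rewrite yrun /=.
  exact: (sat (fst \o y) (fun t => congr1 fst (yrun t)) yfair t.+1).
- have [X1 [U1 [F1 [s1 [r1 H1]]]]] := IHf.
  have [X2 [U2 [F2 [s2 [r2 H2]]]]] := IHg.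
  (* The verdict obeys the expansion law of until, with [x.2] the verdict one position later. The
     [unit] index asks that infinitely often the verdict be false or [g] hold. *)
  exists (X1 * X2 * bool)%type, (U1 + (U2 + unit))%type,
    (fun a x => let x1 := F1 a x.1.1 in let x2 := F2 a x.1.2 in
       (x1, x2, r2 x2 || r1 x1 && x.2)),
    (fun u x => match u with
       | inl u => s1 u x.1.1
       | inr v => match v with
          | inl u => s2 u x.1.2
          | inr _ => ~~ x.2 || r2 x.1.2 end end),
    snd => w.
  have [[x1 [run1 fair1]] sat1] := H1 w; have [[x2 [run2 fair2]] sat2] := H2 w.
  split.
    exists (fun t => (x1 t, x2 t, truth (ltl_sat w t (LUntil f g)))); split.
      move=> t /=; rewrite -run1 -run2; congr (_, _).
      apply/truthP/idP => [/ltl_until_step [/(sat2 x2 run2 fair2) ->//|]|].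
        move=> [/(sat1 x1 run1 fair1) -> /truthP /= ->]; exact: orbT.
      move=> H; apply/ltl_until_step; case/orP: H => [/(sat2 x2 run2 fair2)|].
        by left.
      by case/andP=> /(sat1 x1 run1 fair1) fs /truthP; right.
    case=> [u|[u|[]]]; [exact: fair1|exact: fair2|move=> n /=].
    case: (truthP (ltl_sat w n (LUntil f g))) => [[j [le_nj gj _]]|nU].
      by exists j => //; apply/orP; right; apply/(sat2 x2 run2 fair2).
    by exists n => //; apply/orP; left; apply/truthP.
  move=> x run fx.
  have {}sat1 := sat1 (fun t => (x t).1.1) (fun t => congr1 (fun y => y.1.1) (run t))
                      (fun u => fx (inl u)).
  have {}sat2 := sat2 (fun t => (x t).1.2) (fun t => congr1 (fun y => y.1.2) (run t))
                      (fun u => fx (inr (inl u))).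
  have xS t : (x t).2 = r2 (x t).1.2 || r1 (x t).1.1 && (x t.+1).2.
    by rewrite [in LHS]run /= [in RHS]run.
  move=> t; split.
    (* Fairness gives a later position where the verdict is false or [g] holds; the induction is on
       the distance to it. *)
    have [n le_tn] := fx (inr (inr tt)) t.
    move/subnKC: le_tn; move: (n - t) => m; elim: m t => [|m IHm] t.
      rewrite addn0 => -> /orP [/negP //|/sat2 gn _].
      by apply/ltl_until_step; left.
    rewrite addnS -addSn => e H; rewrite xS => /orP [/sat2|/andP [/sat1 ft xt]].
      by move=> gt; apply/ltl_until_step; left.
    by apply/ltl_until_step; right; split=> //; apply: IHm.
  move=> /= [j [le_tj gj fk]].
  move/subnKC: le_tj fk; move: (j - t) => m; elim: m t => [|m IHm] t.
    by rewrite addn0 => -> _; rewrite xS; apply/orP; left; apply/sat2.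
  rewrite addnS -addSn => e fk; rewrite xS; apply/orP; right.
  have lt_tj : t < j by rewrite -e leq_addr.
  apply/andP; split; first by apply/sat1/fk; rewrite leqnn.
  by apply: IHm => // k /andP [lt_tk lt_kj]; apply: fk; rewrite ltnW.
Qed.

(** * Determinization *)

Section Merging.
Variables (L : Type) (M : finType) (one : M) (mul : M -> L -> M).

Definition block (w : nat -> L) (i k : nat) : M :=
  foldl mul one [seq w t | t <- index_iota i k].

Lemma block_nil w i : block w i i = one.
Proof. by rewrite /block /index_iota subnn. Qed.

Lemma block_rcons w i k : i <= k -> block w i k.+1 = mul (block w i k) (w k).
Proof.
move=> le_ik; rewrite /block /index_iota subSn // -addn1 iotaD map_cat foldl_cat.
by rewrite /= subnKC.
Qed.

(** Blocks grow by one letter on the right, so equal values stay equal. *)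
Lemma block_merge w i j k k' : i <= k -> j <= k -> k <= k' ->
  block w i k = block w j k -> block w i k' = block w j k'.
Proof.
move=> le_ik le_jk le_kk' e; elim: k' le_kk' => [|k' IHk'].
  by rewrite leqn0 => /eqP k0; rewrite -k0.
rewrite leq_eqVlt ltnS => /orP [/eqP <- //|le_kk'].
by rewrite !block_rcons ?IHk' // (leq_trans _ le_kk').
Qed.

Notation slot := 'I_#|M|.+1.

(* Slot [q] holds the value of the block that started at its last reset,
   together with the values that all slots had at that moment. A slot that
   agrees with a smaller one has merged into it and is reset. *)
Definition tracker : finType := ({ffun slot -> M} * {ffun slot -> {ffun slot -> M}})%type.

Definition dead (m : tracker) (q : slot) : bool :=
  [exists p : slot, (p < q) && (m.1 p == m.1 q)].

Definition refresh (m : tracker) : {ffun slot -> M} :=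
  [ffun q => if dead m q then one else m.1 q].

Definition track0 : tracker := ([ffun _ => one], [ffun _ => [ffun _ => one]]).

(** The snapshot [refresh m] is taken after all resets but before [a] is read. *)
Definition track (m : tracker) (a : L) : tracker :=
  ([ffun q => mul (refresh m q) a],
   [ffun q => if dead m q then refresh m else m.2 q]).

Variable w : nat -> L.

Fixpoint tracked (k : nat) : tracker :=
  if k is k'.+1 then track (tracked k') (w k') else track0.

(** The position of the last reset is unbounded, hence kept outside the tracker and used in proofs
    only. *)
Fixpoint born (k : nat) (q : slot) : nat :=
  if k is k'.+1 then (if dead (tracked k') q then k' else born k' q) else 0.

Lemma born_le k q : born k q <= k.
Proof.
by elim: k => //= k IHk; case: ifP => _; [exact: leqnSn|exact: leqW].
Qed.

Lemma tracked_block k q : (tracked k).1 q = block w (born k q) k.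
Proof.
elim: k q => [|k IHk] q; first by rewrite ffunE block_nil.
rewrite /= ffunE /refresh ffunE; case: ifP => _.
  by rewrite block_rcons // block_nil.
by rewrite block_rcons ?born_le // IHk.
Qed.

Lemma refresh_block k q : refresh (tracked k) q = block w (born k.+1 q) k.
Proof. by rewrite /= ffunE; case: ifP; rewrite ?block_nil ?tracked_block. Qed.

(** Slots merge into smaller ones, so slot [ord0] always holds the whole prefix. *)
Lemma dead0 m : dead m ord0 = false.
Proof. by apply/negbTE/existsPn => p. Qed.

Lemma born0 k : born k ord0 = 0.
Proof. by elim: k => //= k ->; rewrite dead0. Qed.

Lemma born_stable T p : (forall t, T <= t -> ~~ dead (tracked t) p) ->
  forall t, T <= t -> born t p = born T p.
Proof.
move=> alive; elim=> [|t IHt]; first by rewrite leqn0 => /eqP ->.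
rewrite leq_eqVlt => /orP [/eqP <- //|le_Tt].
by rewrite /= (negbTE (alive _ _)) ?IHt.
Qed.

Lemma born_after k k' q : dead (tracked k) q -> k < k' -> k <= born k' q.
Proof.
move=> dq; elim: k' => // k' IHk'; rewrite ltnS leq_eqVlt.
case/orP => [/eqP <-|lt_kk'] /=; first by rewrite dq.
by case: ifP => _; [exact: ltnW|exact: IHk'].
Qed.

(** A reset of [q] from [T] on finds in [p] the block that started at [i]. *)
Lemma snapshot_block T i p : (forall t, T <= t -> born t p = i) ->
  forall k q, T <= born k q -> (tracked k).2 q p = block w i (born k q).
Proof.
move=> stable; elim=> [|k IHk] q /=.
  (* When [T] is [0], the initial snapshot counts as one taken at position [0]. *)
  by rewrite leqn0 => /eqP T0; rewrite !ffunE -(stable 0) ?T0 // block_nil.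
rewrite !ffunE; case: ifP => _ le_T; last exact: IHk.
by rewrite refresh_block stable // leqW.
Qed.

Lemma snapshot0_block k q : (tracked k).2 q ord0 = block w 0 (born k q).
Proof. by apply: (@snapshot_block 0) => // t _; rewrite born0. Qed.

(** There is one slot more than there are values. *)
Lemma merging k : exists p q : slot, (p < q) && ((tracked k).1 p == (tracked k).1 q).
Proof.
have /injectivePn [p [q ne e]] : ~~ injectiveb (tracked k).1.
  apply/negP => /injectiveP /leq_card; by rewrite card_ord ltnn.
case: (ltngtP p q) => [lt_pq|lt_qp|/val_inj epq].
- by exists p, q; rewrite lt_pq e eqxx.
- by exists q, p; rewrite lt_qp e eqxx.
- by rewrite epq eqxx in ne.
Qed.

(** The least slot [p] with recurring mergers is eventually never reset: recurring resets would be
    mergers into one smaller slot, against minimality. *)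
Lemma persistent_slot : exists p q : slot,
  io (fun k => (p < q) && ((tracked k).1 p == (tracked k).1 q)) /\
  exists T, forall t, T <= t -> ~~ dead (tracked t) p.
Proof.
have [p [[q ioq] min_p]] : exists p : slot,
    (exists q : slot, io (fun k => (p < q) && ((tracked k).1 p == (tracked k).1 q))) /\
    forall p' : slot, p' < p -> ~ exists q : slot,
      io (fun k => (p' < q) && ((tracked k).1 p' == (tracked k).1 q)).
  apply: ord_min_ex.
  have [p iop] : exists p : slot, io (fun k => exists q : slot,
      (p < q) && ((tracked k).1 p == (tracked k).1 q)).
    apply: io_exists => n; exists n => //; have [p [q pq]] := merging n.
    by exists p, q.
  by exists p; apply: io_exists.
exists p, q; split=> //.
have [|T alive] := proj1 (not_ioP (fun t => dead (tracked t) p)).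
  move=> iod; have [|p' iop'] := @io_exists slot
      (fun p' k => (p' < p) && ((tracked k).1 p' == (tracked k).1 p)).
    by apply: io_mono iod => t /existsP.
  have [t _ /andP [lt_p'p _]] := iop' 0.
  by case: (min_p p' lt_p'p); exists p.
by exists T => t le_Tt; apply/negP; apply: alive.
Qed.

End Merging.

(** * Fair backward runs as a Rabin condition on the tracker *)

Section Determinize.
Variables (L : Type) (X U : finType).
Variables (F : L -> X -> X) (seen : U -> X -> bool).

(** A block maps the state after it to the state before it, and collects the fairness indices seen
    on the way. *)
Definition eff : finType := {ffun X -> X * {set U}}.
Definition eff1 : eff := [ffun x => (x, set0)].
(** The letter appended last is the first one that a backward run reads. *)
Definition eff_mul (m : eff) (a : L) : eff :=
  [ffun x => let y := F a x in ((m y).1, (m y).2 :|: [set u | seen u y])].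

Variable w : nat -> L.
Local Notation blk := (block eff1 eff_mul w).

Lemma blk_split i j k x : i <= j -> j <= k -> (blk i k x).1 = (blk i j (blk j k x).1).1.
Proof.
move=> le_ij; elim: k x => [|k IHk] x.
  by rewrite leqn0 => /eqP ->; rewrite block_nil !ffunE.
rewrite leq_eqVlt ltnS => /orP [/eqP ->|le_jk].
  by rewrite (block_nil _ _ w k.+1) ffunE.
rewrite (block_rcons _ _ _ le_jk) block_rcons ?(leq_trans le_ij) //.
by rewrite !ffunE /= IHk.
Qed.

Lemma blk1 i x : (blk i i.+1 x).1 = F (w i) x.
Proof. by rewrite block_rcons // block_nil ffunE /= ffunE. Qed.

Lemma blk_seen i k x u : i <= k ->
  u \in (blk i k x).2 = [exists t : 'I_k, (i <= t) && seen u (blk t k x).1].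
Proof.
elim: k x => [|k IHk] x.
  rewrite leqn0 => /eqP ->; rewrite block_nil ffunE inE.
  by apply/esym/negbTE/existsPn => -[].
rewrite leq_eqVlt ltnS => /orP [/eqP ->|le_ik].
  rewrite block_nil ffunE inE; apply/esym/negbTE/existsPn => -[t lt_t] /=.
  by rewrite leqNgt lt_t.
rewrite block_rcons // ffunE /= inE IHk // inE.
apply/orP/existsP => [[/existsP [t /andP [le_it su]]|su]|[[t lt_t] /= /andP [le_it]]].
- exists (widen_ord (leqnSn k) t); rewrite /= le_it.
  by rewrite block_rcons ?ffunE //= ltnW.
- by exists ord_max; rewrite /= le_ik blk1.
- move: lt_t; rewrite ltnS => le_tk; move: (le_tk); rewrite leq_eqVlt.
  case/orP=> [/eqP -> |lt_tk]; first by rewrite blk1; right.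
  rewrite block_rcons // ffunE /= => su; left.
  by apply/existsP; exists (Ordinal lt_tk); rewrite /= le_it.
Qed.

Lemma blk_run x : back_run F w x -> forall i k, i <= k -> (blk i k (x k)).1 = x i.
Proof.
move=> run i; elim=> [|k IHk].
  by rewrite leqn0 => /eqP ->; rewrite block_nil ffunE.
rewrite leq_eqVlt ltnS => /orP [/eqP ->|le_ik]; first by rewrite block_nil ffunE.
by rewrite block_rcons // ffunE /= -run IHk.
Qed.

(* Positions that merge into [i] and across which the state [c] reproduces
   itself fairly: repeating [c] at those positions defines a fair run. *)
Lemma fair_run_of_merging (i : nat) (c : X) :
  io (fun j => [/\ i <= j, blk i j c = (c, setT) &
                   exists2 k, j <= k & blk i k = blk j k]) ->
  exists x, [/\ back_run F w x, fair seen x & (blk 0 i c).1 = x 0].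
Proof.
set J := fun j => _; move=> ioJ.
have merge j : J j -> exists2 k, j <= k & forall j', k <= j' -> blk j j' = blk i j'.
  move=> [le_ij _ [k le_jk e]]; exists k => // j' le_kj'.
  by apply/esym; apply: block_merge e => //; apply: leq_trans le_jk.
(* Once [j] has merged into [i], the block from [j] to [j'] acts like the one from [i] to [j'],
   which fixes [c]. *)
have eventual t j : J j -> t <= j ->
    exists k, forall j', J j' -> k <= j' -> (blk t j' c).1 = (blk t j c).1.
  move=> Jj le_tj; have [k le_jk e] := merge j Jj.
  exists k => j' [_ e' _] le_kj'.
  by rewrite (@blk_split t j) ?(leq_trans le_jk) // e // e'.
have unique t j1 j2 : J j1 -> t <= j1 -> J j2 -> t <= j2 ->
    (blk t j1 c).1 = (blk t j2 c).1.
  move=> J1 le1 J2 le2; have [k1 e1] := eventual t j1 J1 le1.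
  have [k2 e2] := eventual t j2 J2 le2; have [j] := ioJ (maxn k1 k2).
  by rewrite geq_max => /andP [le_k1 le_k2] Jj; rewrite -(e1 j) // (e2 j).
have exj t : exists j, t <= j /\ J j by have [j] := ioJ t; exists j.
pose jt t := proj1_sig (constructive_indefinite_description _ (exj t)).
have jtP t : t <= jt t /\ J (jt t) by rewrite /jt; case: constructive_indefinite_description.
(* Carry [c] back to [t] from a position of [J] beyond it; by [unique] the position does not
   matter. *)
pose x t := (blk t (jt t) c).1.
have xE t j : J j -> t <= j -> x t = (blk t j c).1.
  by move=> Jj le_tj; have [le_t Jt] := jtP t; apply: unique.
exists x; split.
- move=> t; have [j lt_tj Jj] := ioJ t.+1.
  rewrite (xE t j) ?(xE t.+1 j) //; last exact: ltnW.
  by rewrite (@blk_split t t.+1) // blk1.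
- move=> u n; have [j le_nj Jj] := ioJ n; have [k le_jk e] := merge j Jj.
  have [j' le_kj' Jj'] := ioJ k; have [_ e' _] := Jj'.
  have le_jj' := leq_trans le_jk le_kj'.
  have: u \in (blk j j' c).2 by rewrite e // e' inE.
  rewrite blk_seen // => /existsP [[t lt_tj'] /= /andP [le_jt su]].
  by exists t; [exact: leq_trans le_jt|rewrite (xE t j') // ltnW].
- have [j le_ij Jj] := ioJ i; have [_ e _] := Jj.
  by rewrite (xE 0 j) // (@blk_split 0 i j) // e.
Qed.

Variable root : X -> bool.
Local Notation slot := 'I_#|eff|.+1.

(* The pair [(p, q, c)] guesses that slot [p] is eventually never reset, that
   slot [q] merges into it infinitely often, and that [c] is the state of the
   backward run at the last reset of [p]. *)
Definition pair_good (i : slot * slot * X) (m : tracker eff) : bool :=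
  [&& i.1.1 < i.1.2, m.1 i.1.1 == m.1 i.1.2 &
      m.2 i.1.2 i.1.1 i.2 == (i.2, setT)].
(** The value of slot [ord0] in the snapshot of [p] carries the guessed state back to position [0].
    Once [p] is no longer reset this test is constant, so acceptance by [root] becomes the absence
    of a recurring event. *)
Definition pair_bad (i : slot * slot * X) (m : tracker eff) : bool :=
  dead m i.1.1 || ~~ root (m.2 i.1.1 ord0 i.2).1.

Local Notation state k := (tracked eff1 eff_mul w k).

Lemma rabin_sound :
  rabin pair_good pair_bad (fun k => state k) ->
  exists x, [/\ back_run F w x, fair seen x & root (x 0)].
Proof.
move=> [[[p q] c] [iog /not_ioP [T nb]]].
have alive t : T <= t -> ~~ dead (state t) p.
  by move=> /nb /negP; rewrite negb_or => /andP [].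
have stable := born_stable alive.
have /negP := nb T (leqnn T); rewrite negb_or negbK => /andP [_] /=.
rewrite snapshot0_block; set i := born _ _ _ _ p => rooti.
have [|x [run fx xi]] := @fair_run_of_merging i c; last first.
  by exists x; split=> //; rewrite -xi.
(* Two good events are used: the first resets [q] beyond [n], so the reset position [j] read at the
   second is large. *)
move=> n; have [k1 le_k1 /and3P [/= lt_pq e1 _]] := iog (maxn n T).
have [k2 lt_k /and3P [/= _ /eqP e2 /eqP snap]] := iog k1.+1.
have dq : dead (state k1) q by apply/existsP; exists p; rewrite lt_pq e1.
have le_b := born_after dq lt_k.
move: le_k1; rewrite geq_max => /andP [le_n le_T].
set j := born _ _ _ k2 q in le_b.
have le_Tj : T <= j by apply: leq_trans le_T le_b.
exists j; first exact: leq_trans le_n le_b.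
have le_ij : i <= j by apply: leq_trans (born_le _ _ _ _ _) le_Tj.
split=> //; first by rewrite -snap (snapshot_block stable).
exists k2; first exact: born_le.
move: e2; rewrite !tracked_block stable //.
by apply: leq_trans le_T (ltnW lt_k).
Qed.

(** Take [p] and [q] from [persistent_slot], and for the guess the state of the run at the final
    reset of [p]. Equal blocks applied to the state at [k2] show that the run is in the same state
    at [i] and [j]. *)
Lemma rabin_complete x :
  back_run F w x -> fair seen x -> root (x 0) ->
  rabin pair_good pair_bad (fun k => state k).
Proof.
move=> run fx rx.
have [p [q [iopq [T alive]]]] := persistent_slot eff1 eff_mul w.
have stable := born_stable alive.
set i := born _ _ _ T p in stable.
have le_iT : i <= T by apply: born_le.
(* Every fairness index occurs between [i] and [N], so a block from [i] reaching beyond [N] sees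
   them all. *)
have [N seenN] : exists N, forall u, exists t, [/\ i <= t, t < N & seen u (x t)].
  have exN u : exists t, (i <= t) && seen u (x t).
    by have [t le_it su] := fx u i; exists t; rewrite le_it.
  exists (\max_u (ex_minn (exN u)).+1) => u; exists (ex_minn (exN u)).
  have := leq_bigmax (F := fun u => (ex_minn (exN u)).+1) u.
  by case: ex_minnP => t /andP [].
exists (p, q, x i); split; last first.
  apply/not_ioP; exists T => t le_Tt; apply/negP.
  rewrite negb_or negbK alive //= snapshot0_block stable //.
  by rewrite blk_run.
move=> n; have [k1 le_k1 /andP [lt_pq e1]] := iopq (maxn N T).
have [k2] := iopq (maxn n k1.+1).
rewrite geq_max => /andP [le_nk2 lt_k] /andP [_ e2].
exists k2 => //; rewrite /pair_good /= lt_pq e2 /=.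
have dq : dead (state k1) q by apply/existsP; exists p; rewrite lt_pq e1.
have le_b := born_after dq lt_k.
move: le_k1; rewrite geq_max => /andP [le_N le_T].
rewrite (snapshot_block stable) ?(leq_trans le_T) //.
move/eqP: e2; rewrite !tracked_block stable ?(leq_trans le_T (ltnW lt_k)) //.
set j := born _ _ _ k2 q in le_b *; move=> e2.
have le_jk : j <= k2 by apply: born_le.
have le_Tj : T <= j by apply: leq_trans le_T le_b.
have le_ij : i <= j by apply: leq_trans le_Tj.
have xij : x i = x j.
  by rewrite -(blk_run run le_jk) -e2 blk_run // (leq_trans le_ij).
rewrite xij [blk i j _]surjective_pairing blk_run // -xij; apply/eqP; congr (_, _).
apply/setP => u; rewrite blk_seen // inE xij.
have [t [le_it lt_tN su]] := seenN u.
have lt_tj : t < j by apply: leq_trans lt_tN (leq_trans le_N le_b).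
by apply/existsP; exists (Ordinal lt_tj); rewrite /= le_it blk_run // ltnW.
Qed.

End Determinize.

(** * Finite memory suffices *)

Section Coalition.
Variables (n : nat) (G : cgs n) (A : {set 'I_n}).
Local Notation profile := {ffun 'I_n -> Act G}.

Definition legal (s : State G) : {set profile} :=
  [set c : profile | [forall j, c j \in Mov s j]].

Lemma legalP s (c : profile) : reflect (forall j, c j \in Mov s j) (c \in legal s).
Proof. by rewrite inE; apply: forallP. Qed.

Definition some_action (s : State G) (j : 'I_n) : Act G :=
  xchoose (set0Pn _ (Mov_neq0 s j)).

Lemma some_actionP s j : some_action s j \in Mov s j.
Proof. exact: xchooseP. Qed.

Lemma legal_neq0 s : legal s != set0.
Proof.
apply/set0Pn; exists [ffun j => some_action s j]; apply/legalP => j.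
by rewrite ffunE some_actionP.
Qed.

(** Total extension of [Tab]; the default [s] is for illegal profiles only. *)
Definition result (s : State G) (c : profile) : State G :=
  if insub c is Some m then @Tab n G s m else s.

Lemma result_move s (m : move s) : result s (val m) = Tab m.
Proof. by rewrite /result valK. Qed.

Lemma legal_move s (c : profile) : c \in legal s ->
  exists m : move s, val m = c /\ Tab m = result s c.
Proof.
rewrite inE => lc; exists (exist _ c lc); split=> //.
by rewrite -result_move.
Qed.

(** The game allows the opponent any profile as an answer, so legality is enforced here, with [c] as
    fallback. *)
Definition mix (s : State G) (c d : profile) : profile :=
  [ffun j => if (j \notin A) && (d j \in Mov s j) then d j else c j].

Lemma mix_legal s (c d : profile) : c \in legal s -> mix s c d \in legal s.
Proof.
by move=> /legalP lc; apply/legalP => j; rewrite ffunE; case: ifP => // /andP [].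
Qed.

Lemma mix_move s (c : profile) (m : move s) :
  (forall a, a \in A -> val m a = c a) -> mix s c (val m) = val m.
Proof.
move=> agree; apply/ffunP => j; rewrite ffunE.
have /forallP -> := valP m; rewrite andbT.
by case: ifPn => // /negPn /agree.
Qed.

End Coalition.

Lemma history_rcons n (G : cgs n) (rho : nat -> State G) l :
  history rho l = rcons (mkseq rho l) (rho l).
Proof. by rewrite /history mkseqS. Qed.

Lemma mem_atS n (G : cgs n) (D : transducer G) rho l :
  mem_at D rho l.+1 = mem_update (mem_at D rho l) (rho l).
Proof. by rewrite /mem_at mkseqS foldl_rcons. Qed.

(** The memory reads all but the last state; [s0] is a default for the empty sequence, which is no
    history. *)
Definition transducer_strategy n (G : cgs n) (s0 : State G) (D : transducer G) :
    strategy G :=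
  fun h => mem_output (foldl (@mem_update _ _ D) (mem_init D) (take (size h).-1 h))
                      (last s0 h).

Lemma transducer_strategyE n (G : cgs n) s0 (D : transducer G) rho l :
  transducer_strategy s0 D (history rho l) = mem_output (mem_at D rho l) (rho l).
Proof.
rewrite /transducer_strategy history_rcons size_rcons last_rcons /=.
by rewrite -cats1 take_size_cat.
Qed.

(** In the product with the tracker, a positional win is a finite-memory strategy. A winning machine
    is impossible: played against [sigma], it would yield an outcome satisfying [phi] whose play is
    nevertheless Streett. *)
Lemma finite_memory_suffices n (AP : finType) (M : cgm n AP) (s : State M)
    (psi : atl0 n AP) :
  atl0_sat PerfectRecall s psi -> atl0_sat FiniteMemory s psi.
Proof.
case: psi => A phi [sigma [strat win]]; rewrite /= in strat win.
have [X [U [F [seen [root proph]]]]] := ltl_prophecy phi.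
pose E := eff X U.
pose Q := tracker E.
pose upd (q : Q) (v : State M) : Q := track (eff1 X U) (eff_mul F seen) q (label v).
pose q0 : Q := track0 (eff1 X U).
pose sc (v : State M * Q) (c d : {ffun 'I_n -> Act M}) :=
  (result v.1 (mix A v.1 c d), upd v.2 v.1).
pose good i (v : State M * Q) := pair_good i v.2.
pose bad i (v : State M * Q) := pair_bad root i v.2.
pose av (v : State M * Q) := legal v.1.
pose word (rho : nat -> State M) i := label (rho i).
pose st rho := tracked (eff1 X U) (eff_mul F seen) (word rho).
have [//|[f [fav fwin]]|[Z Zwin]] :=
    @rabin_determined _ _ _ sc _ good bad av (s, q0); first by move=> v; apply: legal_neq0.
  (* All members run the same tracker and differ in their outputs only. *)
  pose D a := @Transducer n M Q q0 upd (fun q v => f (v, q) a).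
  have memE a rho t : mem_at (D a) rho t = st rho t.
    by elim: t => // t IHt; rewrite mem_atS IHt.
  pose tau a := transducer_strategy s (D a).
  have tauE a rho t : tau a (history rho t) = f (rho t, st rho t) a.
    by rewrite /tau transducer_strategyE memE.
  exists tau => /=; split.
    move=> a _; split.
      by move=> rho l _; rewrite tauE; have /legalP := fav (rho l, st rho l).
    exists #|Q|; first by apply/card_gt0P; exists q0.
    by exists (D a); split=> // rho l _; apply: transducer_strategyE.
  move=> rho [rho0 step].
  have exm i := step i.
  pose ms i := proj1_sig (constructive_indefinite_description _ (exm i)).
  have msP i : (forall a, a \in A -> val (ms i) a = tau a (history rho i)) /\
               Tab (ms i) = rho i.+1.
    by rewrite /ms; case: constructive_indefinite_description.
  have /rabin_sound [x [run fx rx]] :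
      rabin (@pair_good X U) (@pair_bad X U root) (fun k => st rho k).
    apply: (fwin (fun t => (rho t, st rho t)) (fun t => val (ms t))).
      by rewrite rho0.
    move=> t; rewrite /sc /=; have [agree <-] := msP t.
    by rewrite mix_move ?result_move // => a aA; rewrite agree // tauE.
  have [_ sat] := proph (word rho).
  exact/(sat x run fx).
(* Legality of [sigma] is known on outcomes only, and the play to be built is not yet known to be
   one; hence the test and the default. *)
pose choice (h : seq (State M)) (v : State M) : {ffun 'I_n -> Act M} :=
  [ffun a => if (a \in A) && (sigma a h \in Mov v a) then sigma a h
             else some_action v a].
have choice_legal h v : choice h v \in legal v.
  apply/legalP => a; rewrite ffunE; case: ifP => [/andP [] //|_].
  exact: some_actionP.
pose next (x : seq (State M) * (State M * Q) * mstate Z) :=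
  let: (h, v, z) := x in
  let c := choice h v.1 in
  let v' := sc v c (manswer z v c) in (rcons h v'.1, v', mnext z v c).
pose pl t := iter t next ([:: s], (s, q0), minit Z).
pose rho t := (pl t).1.2.1.
have hE t : (pl t).1.1 = history rho t.
  elim: t => // t IHt; rewrite history_rcons -/(history rho t) -IHt /rho /=.
  by case: (pl t) => [[h v] z].
have qE t : (pl t).1.2.2 = st rho t.
  elim: t => // t; rewrite /st /= => <-; rewrite /word /rho.
  by case: (pl t) => [[h v] z].
have vE t : (pl t).1.2 = (rho t, st rho t) by rewrite -qE /rho; case: (pl t).1.2.
pose cs t := choice (history rho t) (rho t).
pose ds t := manswer (pl t).2 (rho t, st rho t) (cs t).
have vS t : (pl t.+1).1.2 = sc (rho t, st rho t) (cs t) (ds t).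
  rewrite /ds /cs -hE -vE /rho /=; by case: (pl t) => [[h v] z].
have zS t : (pl t.+1).2 = mnext (pl t).2 (rho t, st rho t) (cs t).
  rewrite /cs -hE -vE /rho /=; by case: (pl t) => [[h v] z].
have mv t : exists m : move (rho t),
    val m = mix A (rho t) (cs t) (ds t) /\ Tab m = rho t.+1.
  have [m [vm Tm]] := legal_move (mix_legal A (ds t) (choice_legal (history rho t) (rho t))).
  by exists m; split=> //; rewrite Tm [in RHS]/rho vS.
have out : outcome rho by move=> t; have [m []] := mv t; exists m.
have : Out s A sigma rho.
  split=> // t; have [m [vm Tm]] := mv t; exists m; split=> // a aA.
  rewrite vm !ffunE aA /=.
  by have [/(_ rho t out) -> _] := strat a aA.
move=> /win sat_phi.
have [[x [run fx]] sat] := proph (word rho).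
have rx : root (x 0) by apply/(sat x run fx).
have ra := rabin_complete run fx rx.
suff st_play : streett good bad (fun t => (rho t, st rho t)).
  by case: (streett_not_rabin st_play ra).
apply: (Zwin _ (fun t => (pl t).2) cs) => //.
- by move=> t; apply: choice_legal.
- by move=> t; rewrite -vS -vE.
Qed.

(** * Comparison of memory bounds *)

Section Inclusions.
Variables (n : nat) (G : cgs n).

Lemma memoryless_k_memory (sigma : strategy G) :
  memoryless sigma -> k_memory 1 sigma.
Proof.
move=> [f fE]; exists (@Transducer n G unit tt (fun _ _ => tt) (fun _ => f)).
by split; first exact: card_unit.
Qed.

(** The memory size must be exact, so a state [None] is added that is never reached. *)
Lemma k_memoryS k (sigma : strategy G) :
  k_memory k sigma -> k_memory k.+1 sigma.
Proof.
move=> [D [cardD DE]].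
pose D' := @Transducer n G (option (memory D)) (Some (mem_init D))
  (fun m v => omap (fun m => mem_update m v) m)
  (fun m v => if m is Some m' then mem_output m' v
              else mem_output (mem_init D) v).
have memE rho l : mem_at D' rho l = Some (mem_at D rho l).
  by elim: l => // l IHl; rewrite !mem_atS IHl.
exists D'; split; first by rewrite card_option cardD.
by move=> rho l out; rewrite memE DE.
Qed.

End Inclusions.

Lemma models_mono (Y Y' : strategy_type) :
  (forall n (G : cgs n) (j : 'I_n) (sigma : strategy G),
     Strat Y j sigma -> Strat Y' j sigma) ->
  forall t, models Y t -> models Y' t.
Proof.
move=> sub t [sigma [strat win]]; exists sigma; split=> // a aA.
exact: sub (strat a aA).
Qed.

(** * A one-player game, in which the action becomes the next state, separates the memory bounds *)

Lemma flag_agents_gt0 : 0 < 1. Proof. by []. Qed.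
Lemma flag_bool_gt0 : 0 < #|{: bool}|. Proof. by rewrite card_bool. Qed.
Lemma flag_mov_neq0 (s : bool) (j : 'I_1) : [set: bool] != set0.
Proof. by rewrite -card_gt0 cardsT card_bool. Qed.

Definition flag_cgs : cgs 1 :=
  @CGS 1 bool bool (fun _ _ => [set: bool])
    (fun s m => val m ord0) flag_agents_gt0 flag_bool_gt0 flag_bool_gt0 flag_mov_neq0.

Definition flag_cgm : cgm 1 unit :=
  @CGM 1 unit flag_cgs (fun s : bool => if s then [set tt] else set0).

(** The successor case is a conjunction written by De Morgan: the flag is down now, and
    [first_at k'] holds next. *)
Fixpoint first_at (k : nat) : ltl unit :=
  if k is k'.+1 then LNot (LOr (LProp tt) (LNot (LNext (first_at k'))))
  else LProp tt.

Lemma first_atP (rho : nat -> bool) k i :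
  ltl_sat (fun t => label (c := flag_cgm) (rho t)) i (first_at k) <->
  rho (i + k) /\ forall t, t < k -> ~~ rho (i + t).
Proof.
have lab j : (tt \in (if rho j then [set tt] else set0)) = rho j.
  by case: (rho j); rewrite inE.
elim: k i => [|k IHk] i /=; first by rewrite lab addn0; split=> [|[]].
rewrite lab; split=> [H|[Hk H] [Hi|]].
- have ni : ~~ rho i by apply/negP => Hi; apply: H; left.
  have /IHk [Hk Ht] := NNPP _ (fun nH => H (or_intror nH)).
  rewrite addnS -addSn; split=> // -[|t]; first by rewrite addn0.
  by rewrite ltnS addnS -addSn; apply: Ht.
- by have := H 0 isT; rewrite addn0 Hi.
- case; apply/IHk; rewrite addSn -addnS; split=> // t lt_tk.
  by rewrite addSn -addnS; apply: H.
Qed.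

(** Positions [0] to [k] must be false, so the first action [true] falls on position [k]; counting
    up to it takes [k.+1] memory states. *)
Definition flag_triple (k : nat) : triple :=
  @Triple 1 unit flag_cgm false (ATL0 [set: 'I_1] (first_at k.+1)).

Lemma flag_k_memory k : models (KMemory k.+1) (flag_triple k).
Proof.
(* A counter that saturates at [k] and raises the flag from then on. *)
pose D := @Transducer 1 flag_cgs 'I_k.+1 ord0
  (fun m _ => inord (minn m.+1 k)) (fun m _ => val m == k).
exists (fun _ => transducer_strategy (false : State flag_cgs) D); split=> /=.
  move=> a _; split; first by move=> rho l _; rewrite inE.
  by exists D; split=> [|rho l _]; [rewrite /= card_ord|apply: transducer_strategyE].
move=> rho [rho0 step].
have memE l : val (mem_at D rho l) = minn l k.
  elim: l => [|l IHl]; first by rewrite min0n.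
  rewrite mem_atS /= inordK ?ltnS ?geq_minr // IHl.
  have [le_kl|//] := leqP k l.
  by rewrite (minn_idPr (leqnSn k)) (minn_idPr (leqW le_kl)).
have rhoS l : rho l.+1 = (k <= l).
  have [m [agree <-]] := step l.
  rewrite [LHS](agree ord0 _) ?inE // transducer_strategyE /= memE.
  by rewrite eqn_leq geq_minr leq_min leqnn andbT.
apply/(first_atP rho k.+1 0); rewrite !add0n rhoS leqnn; split=> // -[|t].
  by rewrite add0n rho0.
by rewrite ltnS add0n rhoS -ltnNge.
Qed.

(* While the state is [false] the memory runs deterministically, so among the
   first [k.+1] memory states two coincide and the flag would already have
   been raised earlier. *)
Lemma flag_not_k_memory k : ~ models (KMemory k) (flag_triple k).
Proof.
move=> [sigma [/(_ ord0) strat win]].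
have [|_ [D [cardD DE]]] := strat; first by rewrite inE.
pose pl t := iter t (fun x : memory D * bool =>
  (mem_update x.1 (x.2 : State flag_cgs), mem_output x.1 (x.2 : State flag_cgs)))
  (mem_init D, false).
pose rho t : State flag_cgs := (pl t).2.
have memE t : mem_at D rho t = (pl t).1 by elim: t => // t IHt; rewrite mem_atS IHt.
have mv t : exists m : move (rho t), val m ord0 = rho t.+1.
  have [|m [em _]] := @legal_move 1 flag_cgs (rho t) [ffun _ => rho t.+1].
    by apply/legalP => j; rewrite inE.
  by exists m; rewrite em ffunE.
have out : outcome rho by move=> t; have [m em] := mv t; exists m.
have /win /(first_atP rho k.+1 0) : Out (false : State flag_cgm) [set: 'I_1] sigma rho.
  split=> // t; have [m em] := mv t; exists m; split=> // a _.
  by rewrite (ord1 a) em DE // memE.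
rewrite add0n => -[high low].
have stay t : t <= k -> rho t = false.
  by move=> le_tk; apply/negbTE; rewrite -[t]add0n; apply: low.
have /injectivePn [i [j ne e]] : ~~ injectiveb (fun i : 'I_k.+1 => (pl i).1).
  by apply/negP => /injectiveP /leq_card; rewrite card_ord cardD ltnn.
wlog lt_ij : i j ne e / i < j.
  move=> H; case: (ltngtP i j) => [|lt_ji|/val_inj eij]; first exact: H.
    by apply: (H j i) => //; rewrite eq_sym.
  by rewrite eij eqxx in ne.
have le_jk : j <= k by rewrite -ltnS.
(* Equal memories and lowered flags evolve alike as long as the later copy stays within the first
   [k] steps. *)
have same d : j + d <= k -> pl (i + d) = pl (j + d).
  elim: d => [|d IHd] le_d.
    rewrite !addn0 [LHS]surjective_pairing [RHS]surjective_pairing e.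
    by rewrite -/(rho i) -/(rho j) !stay // (leq_trans (ltnW lt_ij)).
  by rewrite !addnS /= IHd // ltnW // -addnS.
(* The step that raises the flag at [k.+1] is copied [j - i] positions earlier, where the flag must
   still be down. *)
have eq_high : rho (i + (k - j)).+1 = rho k.+1.
  by rewrite /rho /= same ?subnKC.
have := stay (i + (k - j)).+1; rewrite eq_high high => /(_ _) absurd.
suff /absurd : (i + (k - j)).+1 <= k by [].
by rewrite -[X in _ <= X](subnKC le_jk) -addSn leq_add2r.
Qed.

Lemma Strat_KMemoryS k n (G : cgs n) (j : 'I_n) (sigma : strategy G) :
  Strat (KMemory k) j sigma -> Strat (KMemory k.+1) j sigma.
Proof. by case=> legal /k_memoryS. Qed.

Theorem mainTheorem1 :
  strictly_included (models Memoryless) (models (KMemory 2)) /\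
  (forall k : nat, 2 <= k ->
     strictly_included (models (KMemory k)) (models (KMemory k.+1)) /\
     strictly_included (models (KMemory k)) (models FiniteMemory)) /\
  same_set (models FiniteMemory) (models PerfectRecall).
Proof.
have sub1 t : models Memoryless t -> models (KMemory 1) t.
  by apply: models_mono => n G j sigma [legal /memoryless_k_memory].
have subS k t : models (KMemory k) t -> models (KMemory k.+1) t.
  by apply: models_mono => n G j sigma; apply: Strat_KMemoryS.
have subF k t : models (KMemory k.+1) t -> models FiniteMemory t.
  by apply: models_mono => n G j sigma [legal mem]; split=> //; exists k.+1.
split; [|split].
- split; first by move=> t /sub1; apply: subS.
  by exists (flag_triple 1); split=> [|/sub1]; [exact: flag_k_memory|exact: flag_not_k_memory].
- move=> k _; split; split.
  + exact: subS.
  + by exists (flag_triple k); split; [exact: flag_k_memory|exact: flag_not_k_memory].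
  + by move=> t /subS; apply: subF.
  + exists (flag_triple k); split; last exact: flag_not_k_memory.
    by apply: subF; apply: flag_k_memory.
- move=> [n AP M s psi]; split; last exact: finite_memory_suffices.
  by apply: models_mono => n' G j sigma [].
Qed.
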